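(* Let $2\le r_1<r_2$ be integers, let $T=[h,q_1,q_2]\in\mathfrak{F}(n)$ with $h\ge3$, and let $\tilde T=[h',q_1',q_2']$ where either $h'=h-1$, $q_1'=q_1+1$, $q_2'=q_2$, or $h'=h-1$, $q_1'=q_1$, $q_2'=q_2+1$. Then $\rho(T)>\rho(\tilde T)$.
   Context: $\rho(G)$ denotes the spectral radius (largest eigenvalue of the adjacency matrix) of a graph $G$. For integers $h,q_1,q_2\ge 1$ and fixed integers $2\le r_1<r_2$, the tree $[h,q_1,q_2]$ is constructed as follows: take a vertex $u$; attach to $u$ a pendant path with $h$ edges; attach to $u$ a path with $q_1$ edges ending at a vertex $v_1$, and attach to $v_1$ exactly $r_1$ pendant paths with $2$ edges each; attach to $u$ a path with $q_2$ edges ending at a vertex $v_2$, and attach to $v_2$ exactly $r_2$ pendant paths with $2$ edges each. It has $n=1+h+q_1+q_2+2(r_1+r_2)$ vertices. $\mathfrak{F}(n)$ is the set of all such trees $[h,q_1,q_2]$ with $h,q_1,q_2\ge2$ and $h+q_1+q_2=n-1-2(r_1+r_2)$. The tree $\tilde T$ is obtained from $T$ by a 2-switch (removing two edges $ab,cd$ with $ac,bd$ non-edges and adding $ac,bd$), so it has the same degree sequence. *)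

(* Defs.v *)
From HB Require Import structures.
From mathcomp Require Import all_boot all_order all_algebra.
From mathcomp Require Import classical_sets reals.
Set Implicit Arguments. Unset Strict Implicit. Unset Printing Implicit Defensive.
Import Order.TTheory GRing.Theory Num.Theory.

(* Spectral radius: the largest eigenvalue of a real square matrix
   (supremum of the set of its real eigenvalues; for the symmetric adjacency
   matrices used below this set is finite and nonempty, so it is the max). *)
Definition spectral_radius (R : realType) (n : nat) (A : 'M[R]_n) : R :=
  sup [set a : R | eigenvalue A a].

(* The tree [h,q1,q2] with parameters r1 r2, on vertices 0 .. n-1:
   u = 0;
   pendant path (h edges): 1 .. h, with 1 adjacent to u;
   path to v1 (q1 edges): h+1 .. h+q1, h+1 adjacent to u, v1 = h+q1;
   path to v2 (q2 edges): h+q1+1 .. h+q1+q2, h+q1+1 adjacent to u, v2 = h+q1+q2;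
   r1 pendant P2's at v1: vertices b1+2j (adjacent to v1), b1+2j+1
     (adjacent to b1+2j), j < r1, where b1 = h+q1+q2+1;
   r2 pendant P2's at v2: vertices b2+2j (adjacent to v2), b2+2j+1
     (adjacent to b2+2j), j < r2, where b2 = b1+2*r1.
   The tree is encoded by the parent of each vertex x > 0. *)
Definition tree_order (r1 r2 h q1 q2 : nat) : nat :=
  1 + h + q1 + q2 + 2 * (r1 + r2).

Definition tree_parent (r1 r2 h q1 q2 x : nat) : nat :=
  let v1 := h + q1 in
  let v2 := h + q1 + q2 in
  let b1 := h + q1 + q2 + 1 in
  let b2 := b1 + 2 * r1 in
  if x <= h then x.-1
  else if x == h + 1 then 0
  else if x <= h + q1 then x.-1
  else if x == h + q1 + 1 then 0
  else if x <= h + q1 + q2 then x.-1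
  else if x < b2 then (if ~~ odd (x - b1) then v1 else x.-1)
  else (if ~~ odd (x - b2) then v2 else x.-1).

Definition tree_adj (r1 r2 h q1 q2 x y : nat) : bool :=
  ((0 < x) && (tree_parent r1 r2 h q1 q2 x == y)) ||
  ((0 < y) && (tree_parent r1 r2 h q1 q2 y == x)).

Definition tree_adjmx (R : realType) (r1 r2 h q1 q2 : nat)
  : 'M[R]_(tree_order r1 r2 h q1 q2) :=
  \matrix_(i, j) ((tree_adj r1 r2 h q1 q2 i j)%:R)%R.

(* Main.v *)
Require Import Defs.
From HB Require Import structures.
From mathcomp Require Import all_boot all_order all_algebra.
From mathcomp Require Import classical_sets reals.
From mathcomp Require Import zify ring lra.
Import Order.TTheory GRing.Theory Num.Theory.
Local Open Scope ring_scope.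

(* Perron vectors replace explicit eigenvalue computations.  The spectral
   radius of a symmetric matrix is the maximum of its Rayleigh quotient, so the
   tree T has a positive eigenvector x for lam = rho(T), and any nonnegative y
   on another tree with A y <= lam y, strictly somewhere, forces its spectral
   radius to be < lam.  Such a y is obtained from x in two moves: lengthening
   the internal path from u to v_i by one edge repeats a smallest entry of x on
   that path (Hoffman-Smith), and dropping the leaf of the pendant path makes
   the inequality strict at its neighbour.  The pendant paths with 2 edges at
   v_i are eliminated: r of them contribute the factor r lam / (lam^2 - 1) at
   v_i. *)

(** * Quadratic forms, Rayleigh quotients and nonnegative eigenvectors *)

Definition bform {R : realType} {n : nat} (A : 'M[R]_n) (x y : 'rV[R]_n) : R :=
  (x *m A *m y^T) 0 0.

Section Rayleigh.
Context {R : realType} {n : nat}.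
Implicit Types (A B M : 'M[R]_n) (x y z : 'rV[R]_n).

Lemma bformE A x y : bform A x y = \sum_i \sum_j x 0 i * A i j * y 0 j.
Proof.
rewrite /bform mxE exchange_big /=; apply: eq_bigr => j _.
by rewrite !mxE big_distrl.
Qed.

Lemma bform_sym A x y : A^T = A -> bform A x y = bform A y x.
Proof.
move=> sA; rewrite /bform -[in LHS](trmxK (x *m A *m y^T)) mxE.
by rewrite !trmx_mul trmxK sA mulmxA.
Qed.

Lemma bform_expand A (s t : R) x y : A^T = A ->
  bform A (s *: x + t *: y) (s *: x + t *: y) =
  s ^+ 2 * bform A x x + 2 * s * t * bform A x y
  + t ^+ 2 * bform A y y.
Proof.
move=> sA; have := bform_sym A x y sA; rewrite /bform => sxy.
rewrite linearD /= !linearZ /= !mulmxDl !mulmxDr -!scalemxAl -!scalemxAr.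
have E (P Q : 'M[R]_1) : (P + Q) 0 0 = P 0 0 + Q 0 0 by rewrite mxE.
have F a (P : 'M[R]_1) : (a *: P) 0 0 = a * P 0 0 by rewrite mxE.
rewrite !E !F sxy; ring.
Qed.

(** The form is only semidefinite. If [bform A w w] is positive, evaluate the form at the
    combination of [z] and [w] orthogonal to [w]. If both diagonal values vanish, its value at
    [x - b y], with [b = bform A x y], is [-2 b^2], so [b = 0]. *)
Lemma psd_cauchy_schwarz A x y : A^T = A ->
  (forall z, 0 <= bform A z z) ->
  bform A x y ^+ 2 <= bform A x x * bform A y y.
Proof.
move=> sA pA.
have strict z w : 0 < bform A w w ->
    bform A z w ^+ 2 <= bform A z z * bform A w w.
  move=> w0; have := pA (bform A w w *: z + (- bform A z w) *: w).
  rewrite bform_expand //; set a := bform _ z z; set b := bform _ z w.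
  set c := bform _ w w in w0 *; move=> h.
  have : 0 <= c * (a * c - b ^+ 2) by apply: le_trans h _; lra.
  by rewrite pmulr_rge0 // subr_ge0.
have := pA y; rewrite le_eqVlt => /orP [/eqP y0|]; last exact: strict.
have := pA x; rewrite le_eqVlt => /orP [/eqP x0|x0]; last first.
  by rewrite bform_sym // mulrC; apply: strict.
have := pA (1 *: x + (- bform A x y) *: y); rewrite bform_expand // -x0 -y0.
set b := bform _ x y => h; nra.
Qed.

Lemma bform1E x : bform 1%:M x x = \sum_i x 0 i ^+ 2.
Proof.
by rewrite /bform mulmx1 mxE; apply: eq_bigr => i _; rewrite !mxE expr2.
Qed.

Lemma bform1_ge0 x : 0 <= bform 1%:M x x.
Proof. by rewrite bform1E sumr_ge0 // => i _; rewrite sqr_ge0. Qed.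

Lemma bform1_gt0 x : x != 0 -> 0 < bform 1%:M x x.
Proof.
move=> x0; rewrite lt_def bform1_ge0 andbT; apply: contraNneq x0 => h.
apply/eqP/rowP => i; rewrite mxE; apply/eqP; rewrite -sqrf_eq0; apply/eqP.
by move: h; rewrite bform1E => /psumr_eq0P; apply=> // j _; rewrite sqr_ge0.
Qed.

(** A crude bound, from [|x_i x_j| <= |x|^2]. It makes the set of Rayleigh quotients bounded and
    also controls the form of an inverse matrix. *)
Lemma bform_le_entries M x :
  bform M x x <= (\sum_i \sum_j `|M i j|) * bform 1%:M x x.
Proof.
rewrite bformE big_distrl; apply: ler_sum => i _.
rewrite big_distrl; apply: ler_sum => j _ /=.
have sq k : x 0 k ^+ 2 <= bform 1%:M x x.
  rewrite bform1E (bigD1 k) //= lerDl; apply: sumr_ge0 => l _; exact: sqr_ge0.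
apply: le_trans (ler_norm _) _; rewrite !normrM mulrAC mulrC.
apply: ler_wpM2l => //.
have := sq i; have := sq j; rewrite -(real_normK (num_real (x 0 i))).
rewrite -(real_normK (num_real (x 0 j))); have := sqr_ge0 (`|x 0 i| - `|x 0 j|).
move: `|_| `|_| (bform _ _ _) => a b c; nra.
Qed.

Lemma bform_shift A (m : R) x y :
  bform (m%:M - A) x y = m * bform 1%:M x y - bform A x y.
Proof.
rewrite /bform mulmxBr mulmxBl mul_mx_scalar mulmx1 -scalemxAl.
by rewrite [LHS]mxE [X in X + _]mxE [X in _ + X]mxE.
Qed.

(* If the supremum [m] of the Rayleigh quotient were not an eigenvalue,
   Cauchy-Schwarz for the form of [m - A] applied to [x] and [x (m - A)^-1]
   would bound that form below by a multiple of |x|^2. *)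
Lemma rayleigh_max A : (0 < n)%N -> A^T = A ->
  exists m : R, eigenvalue A m /\
    forall x, bform A x x <= m * bform 1%:M x x.
Proof.
move=> n0 sA.
pose S := [set a : R | exists2 x, x != 0 &
  a = bform A x x / bform 1%:M x x]%classic.
have S0 : (S !=set0)%classic.
  pose x : 'rV[R]_n := const_mx 1.
  exists (bform A x x / bform 1%:M x x); exists x => //.
  apply/negP => /eqP /rowP /(_ (Ordinal n0)); rewrite !mxE => /eqP.
  by rewrite oner_eq0.
have Sub : has_ubound S.
  exists (\sum_i \sum_j `|A i j|) => _ [x x0 ->].
  by rewrite ler_pdivrMr ?bform1_gt0 //; exact: bform_le_entries.
pose m := sup S; exists m.
have rayl x : bform A x x <= m * bform 1%:M x x.
  have [->|x0] := eqVneq x 0; first by rewrite /bform !mul0mx !mxE mulr0.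
  rewrite -ler_pdivrMr ?bform1_gt0 //; apply: ub_le_sup => //.
  by exists x.
split=> //; pose B := m%:M - A.
have sB : B^T = B by rewrite /B linearB /= tr_scalar_mx sA.
have pB z : 0 <= bform B z z by rewrite bform_shift subr_ge0.
rewrite /eigenvalue /eigenspace kermx_eq0 row_free_unit -opprB -/B.
apply/negP => uB'; have {uB'} uB : B \in unitmx.
  by rewrite -(opprK B) -scaleN1r unitmxZ // unitrN1.
(* The transpose appears because the form of [B] at [x B^-1] is [x (B^-1)^T x^T]. The added 1 makes
   [C] positive, so that [C^-1] is a genuine gap below the supremum [m]. *)
pose M := (invmx B)^T; pose C := \sum_i \sum_j `|M i j| + 1.
have C0 : 0 < C.
  rewrite /C ltr_wpDl ?ltr01 //; do 2! apply: sumr_ge0 => ? _.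
  exact: normr_ge0.
suff : m <= m - C^-1 by rewrite lerBrDr gerDl leNgt invr_gt0 C0.
apply: ge_sup => // _ [x x0 ->]; have xp := bform1_gt0 x x0.
rewrite ler_pdivrMr // mulrBl lerBrDr -lerBrDl -bform_shift -/B.
have := psd_cauchy_schwarz B x (x *m invmx B) sB pB.
have -> : bform B x (x *m invmx B) = bform 1%:M x x.
  rewrite /bform trmx_mul -mulmxA [B *m _]mulmxA.
  by rewrite -{1}sB -trmx_mul mulVmx // trmx1 mulmx1 mul1mx.
have -> : bform B (x *m invmx B) (x *m invmx B) = bform M x x.
  by rewrite /bform mulmxKV // trmx_mul mulmxA.
have qC : bform M x x <= C * bform 1%:M x x.
  apply: le_trans (bform_le_entries M x) _.
  by rewrite ler_wpM2r ?lerDl ?ler01 // ltW.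
have Q0 := pB x.
move=> cs; rewrite ler_pdivrMl //.
rewrite -(ler_pM2r xp) -expr2; apply: (le_trans cs).
by apply: le_trans (ler_wpM2l Q0 qC) _; rewrite mulrCA mulrA.
Qed.

Lemma eigenvalue_le_rayleigh A (m a : R) :
  (forall x, bform A x x <= m * bform 1%:M x x) ->
  eigenvalue A a -> a <= m.
Proof.
move=> rayl /eigenvalueP [v va v0]; have := rayl v.
rewrite {1}/bform va -scalemxAl -[X in _ *: (X *m _)]mulmx1.
by rewrite [X in X <= _]mxE ler_pM2r // bform1_gt0.
Qed.

(** The maximum of the Rayleigh quotient is an eigenvalue and bounds all the others, so it is the
    supremum that defines [spectral_radius]. *)
Lemma spectral_radius_rayleigh A : (0 < n)%N -> A^T = A ->
  eigenvalue A (spectral_radius A) /\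
  forall x, bform A x x <= spectral_radius A * bform 1%:M x x.
Proof.
move=> n0 sA; have [m [em rayl]] := rayleigh_max A n0 sA.
suff -> : spectral_radius A = m by [].
have ubm : ubound [set a : R | eigenvalue A a]%classic m.
  by move=> a; apply: eigenvalue_le_rayleigh.
apply/eqP; rewrite eq_le; apply/andP; split.
  by apply: ge_sup => //; exists m.
by apply: ub_le_sup => //; exists m.
Qed.

(** Taking absolute values in a top eigenvector keeps its norm and does not decrease the form of
    [A], so the resulting [w] still maximises the Rayleigh quotient. *)
Lemma perron_nonneg A : (0 < n)%N -> A^T = A -> (forall i j, 0 <= A i j) ->
  exists x, [/\ x != 0, forall i, 0 <= x 0 i & x *m A = spectral_radius A *: x].
Proof.
move=> n0 sA A0; have [em rayl] := spectral_radius_rayleigh A n0 sA.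
set m := spectral_radius A in em rayl *.
have [v va v0] := eigenvalueP em; pose w : 'rV[R]_n := \row_i `|v 0 i|.
have w0 : w != 0.
  apply: contraNneq v0 => /rowP h; apply/eqP/rowP => i.
  by apply/eqP; have := h i; rewrite !mxE => /eqP; rewrite normr_eq0.
exists w; split=> //; first by move=> i; rewrite mxE.
pose B := m%:M - A.
have sB : B^T = B by rewrite /B linearB /= tr_scalar_mx sA.
have pB z : 0 <= bform B z z by rewrite bform_shift subr_ge0.
have wB : bform B w w = 0.
  apply/eqP; rewrite eq_le pB andbT bform_shift subr_le0.
  have -> : bform 1%:M w w = bform 1%:M v v.
    rewrite !bform1E; apply: eq_bigr => i _.
    by rewrite mxE real_normK // num_real.
  have -> : m * bform 1%:M v v = bform A v v.
    by rewrite /bform va mulmx1 -scalemxAl [RHS]mxE.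
  rewrite !bformE; do 2! (apply: ler_sum => ? _); rewrite !mxE.
  by apply: le_trans (ler_norm _) _; rewrite !normrM (ger0_norm (A0 _ _)).
(* The semidefinite form of [B] vanishes at [w], so Cauchy-Schwarz against [w B] gives
   [|w B|^2 = bform B w (w B) = 0]. *)
suff h : w *m B = 0.
  by apply/esym/eqP; rewrite -subr_eq0 -mul_mx_scalar -mulmxBr -/B h.
have := psd_cauchy_schwarz B w (w *m B) sB pB.
rewrite wB mul0r => h; have {h} : bform B w (w *m B) = 0.
  by apply/eqP; rewrite -sqrf_eq0 eq_le h sqr_ge0.
move=> h; apply/eqP; apply: contraTT isT => /bform1_gt0.
by rewrite {1}/bform mulmx1 -/(bform B w (w *m B)) h ltxx.
Qed.

(** Pairing [A y <= lam y] with the positive eigenvector [z] gives [rho <z,y> < lam <z,y>], strict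
    because the entry of [z] at [i0] is positive. *)
Lemma spectral_radius_lt A (lam : R) y z i0 : A^T = A ->
  (forall i, 0 < z 0 i) -> z *m A = spectral_radius A *: z ->
  (forall i, 0 <= y 0 i) ->
  (forall i, \sum_j A i j * y 0 j <= lam * y 0 i) ->
  \sum_j A i0 j * y 0 j < lam * y 0 i0 ->
  spectral_radius A < lam.
Proof.
move=> sA z0 za y0 yle ylt.
pose d := \sum_i z 0 i * y 0 i.
have d0 : 0 <= d by apply: sumr_ge0 => i _; rewrite mulr_ge0 // ltW.
suff h : spectral_radius A * d < lam * d.
  (* If [d] were 0, both sides of the strict inequality would vanish. *)
  have d0gt : 0 < d.
    by rewrite lt_def d0 andbT; apply: contraTneq h => ->; rewrite !mulr0 ltxx.
  by rewrite -(ltr_pM2r d0gt).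
have -> : spectral_radius A * d = \sum_i z 0 i * (\sum_j A i j * y 0 j).
  have -> : spectral_radius A * d = bform A z y.
    rewrite /bform za -scalemxAl mxE; congr (_ * _).
    by rewrite mxE; apply: eq_bigr => i _; rewrite !mxE.
  rewrite bformE; apply: eq_bigr => i _; rewrite big_distrr /=.
  by apply: eq_bigr => j _; rewrite mulrA.
rewrite /d big_distrr /= (bigD1 i0) //= [X in _ < X](bigD1 i0) //=.
apply: ltr_leD; first by rewrite mulrCA ltr_pM2l.
by apply: ler_sum => i _; rewrite mulrCA ler_wpM2l // ltW.
Qed.

End Rayleigh.

(** * Neighbour sums in the tree [[h,q1,q2]] *)

Lemma tree_parent_lt (r1 r2 h q1 q2 x : nat) :
  (0 < x)%N -> (tree_parent r1 r2 h q1 q2 x < x)%N.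
Proof. rewrite /tree_parent; repeat case: ifP; lia. Qed.

(** Replaces a sum weighted by adjacency with a sum over an explicit list of neighbours. *)
Lemma sum_mem_seq (R : realType) (n : nat) (p : pred nat) (s : seq nat)
  (F : nat -> R) : uniq s -> all (fun k => k < n)%N s ->
  (forall j, (j < n)%N -> p j = (j \in s)) ->
  \sum_(j < n) (p j)%:R * F j = \sum_(k <- s) F k.
Proof.
move=> us /allP sn ps.
rewrite (eq_bigr (fun j : 'I_n => if p j then F j else 0)); last first.
  by move=> j _; case: (p j); rewrite ?mul1r ?mul0r.
rewrite -big_mkcond /= -(big_mkord p F) -big_filter; apply: perm_big.
apply: uniq_perm => //; first by rewrite filter_uniq // iota_uniq.
move=> k; rewrite mem_filter mem_iota /= add0n subn0.
case kn: (k < n)%N; first by rewrite andbT ps.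
by rewrite andbF; apply/esym/negP => /sn; rewrite kn.
Qed.

(* [path_vertex h i] is the i-th vertex, counted from u = 0, of a path whose
   vertices other than u are h+1, h+2, ... *)
Definition path_vertex (h i : nat) : nat := if i == 0%N then 0%N else (h + i)%N.

Section TreeSum.
Context {R : realType}.
Variables (r1 r2 h q1 q2 : nat).
Hypotheses (h2 : (2 <= h)%N) (q12 : (2 <= q1)%N) (q22 : (2 <= q2)%N).
Local Notation n := (tree_order r1 r2 h q1 q2).
Local Notation adj := (tree_adj r1 r2 h q1 q2).
Local Notation v1 := (h + q1)%N.
Local Notation v2 := (h + q1 + q2)%N.
Local Notation b1 := (h + q1 + q2 + 1)%N.
Local Notation b2 := (h + q1 + q2 + 1 + 2 * r1)%N.
Local Notation pa := (path_vertex 0).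
Local Notation pb := (path_vertex h).
Local Notation pc := (path_vertex v1).

(** Row [i] of the adjacency matrix applied to [F]. Indexing [F] by natural numbers lets neighbours
    be written as arithmetic expressions. *)
Definition nbr_sum (i : nat) (F : nat -> R) : R :=
  \sum_(j < n) (adj i j)%:R * F j.

(** Sorts the vertices by the shape of their neighbourhood: root, interiors and ends of the three
    paths, then middle vertices and leaves of the pendant paths with 2 edges, whose index is half
    the offset. *)
Lemma nbr_sum_cases (P : nat -> Prop) :
  P 0%N -> (forall i, (0 < i < h)%N -> P (pa i)) -> P (pa h) ->
  (forall i, (0 < i < q1)%N -> P (pb i)) -> P (pb q1) ->
  (forall i, (0 < i < q2)%N -> P (pc i)) -> P (pc q2) ->
  (forall k, (k < r1)%N -> P (b1 + 2 * k)%N /\ P (b1 + 2 * k + 1)%N) ->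
  (forall k, (k < r2)%N -> P (b2 + 2 * k)%N /\ P (b2 + 2 * k + 1)%N) ->
  forall i, (i < n)%N -> P i.
Proof.
move=> P0 Pa Pah Pb Pbq Pc Pcq Pm1 Pm2 i; rewrite /tree_order => ilt.
have [->//|i0] := eqVneq i 0%N.
have [ih|ih] := leqP i h.
  have -> : i = pa i by rewrite /path_vertex; case: eqP; lia.
  have [->//|ih'] := eqVneq i h; apply: Pa; lia.
have [ib|ib] := leqP i v1.
  have -> : i = pb (i - h) by rewrite /path_vertex; case: eqP; lia.
  have [->//|] := eqVneq (i - h)%N q1; move=> ?; apply: Pb; lia.
have [ic|ic] := leqP i v2.
  have -> : i = pc (i - v1) by rewrite /path_vertex; case: eqP; lia.
  have [->//|] := eqVneq (i - v1)%N q2; move=> ?; apply: Pc; lia.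
have [im|im] := ltnP i b2.
  have [|P1 P2] := Pm1 ((i - b1) %/ 2)%N; first by lia.
  have [->|->] // : i = (b1 + 2 * ((i - b1) %/ 2))%N \/
    i = (b1 + 2 * ((i - b1) %/ 2) + 1)%N by lia.
have [|P1 P2] := Pm2 ((i - b2) %/ 2)%N; first by lia.
have [->|->] // : i = (b2 + 2 * ((i - b2) %/ 2))%N \/
  i = (b2 + 2 * ((i - b2) %/ 2) + 1)%N by lia.
Qed.

Ltac crush := rewrite /tree_adj /tree_parent /tree_order /path_vertex ?inE /=;
  repeat case: ifP; lia.
(** [p] is the parent of the vertex and [s] its full list of neighbours. For the root, [p] is the
    default value 0, which the guard [0 < x] in [tree_adj] discards. *)
Ltac nbrs p s :=
  rewrite /nbr_sum;
  match goal with |- context [tree_adj _ _ _ _ _ ?i _] =>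
    have : tree_parent r1 r2 h q1 q2 i = p by crush
  end; move=> ?;
  rewrite (@sum_mem_seq _ _ _ s);
  [ rewrite ?big_cons ?big_nil ?addr0 ?addrA | rewrite /= ?inE; crush
  | rewrite /=; crush | move=> j; rewrite /tree_adj;
    match goal with E : tree_parent _ _ _ _ _ _ = _ |- _ => rewrite E end;
    crush].

Lemma nbr_sum_u F : nbr_sum 0 F = F (pa 1) + F (pb 1) + F (pc 1).
Proof. by nbrs 0%N [:: pa 1; pb 1; pc 1]. Qed.

Lemma nbr_sum_a i F : (0 < i < h)%N ->
  nbr_sum (pa i) F = F (pa i.-1) + F (pa i.+1).
Proof. by move=> ?; nbrs (pa i.-1) [:: pa i.-1; pa i.+1]. Qed.

Lemma nbr_sum_a_end F : nbr_sum (pa h) F = F (pa h.-1).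
Proof. by nbrs (pa h.-1) [:: pa h.-1]. Qed.

Lemma nbr_sum_b i F : (0 < i < q1)%N ->
  nbr_sum (pb i) F = F (pb i.-1) + F (pb i.+1).
Proof. by move=> ?; nbrs (pb i.-1) [:: pb i.-1; pb i.+1]. Qed.

Lemma nbr_sum_c i F : (0 < i < q2)%N ->
  nbr_sum (pc i) F = F (pc i.-1) + F (pc i.+1).
Proof. by move=> ?; nbrs (pc i.-1) [:: pc i.-1; pc i.+1]. Qed.

Lemma nbr_sum_mid1 k F : (k < r1)%N ->
  nbr_sum (b1 + 2 * k)%N F = F (pb q1) + F (b1 + 2 * k + 1)%N.
Proof. by move=> ?; nbrs (pb q1) [:: pb q1; (b1 + 2 * k + 1)%N]. Qed.

Lemma nbr_sum_leaf1 k F : (k < r1)%N ->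
  nbr_sum (b1 + 2 * k + 1)%N F = F (b1 + 2 * k)%N.
Proof. by move=> ?; nbrs (b1 + 2 * k)%N [:: (b1 + 2 * k)%N]. Qed.

Lemma nbr_sum_mid2 k F : (k < r2)%N ->
  nbr_sum (b2 + 2 * k)%N F = F (pc q2) + F (b2 + 2 * k + 1)%N.
Proof. by move=> ?; nbrs (pc q2) [:: pc q2; (b2 + 2 * k + 1)%N]. Qed.

Lemma nbr_sum_leaf2 k F : (k < r2)%N ->
  nbr_sum (b2 + 2 * k + 1)%N F = F (b2 + 2 * k)%N.
Proof. by move=> ?; nbrs (b2 + 2 * k)%N [:: (b2 + 2 * k)%N]. Qed.

Lemma mem_even_block (b r j : nat) :
  (j \in [seq (b + 2 * k)%N | k <- iota 0 r]) =
  [&& (b <= j)%N, (j < b + 2 * r)%N & ~~ odd (j - b)].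
Proof.
apply/mapP/and3P => [[k]|[bj jb oj]].
  by rewrite mem_iota => kr ->; split; lia.
exists ((j - b) %/ 2)%N; rewrite ?mem_iota; lia.
Qed.

Lemma uniq_even_block (b r : nat) : uniq [seq (b + 2 * k)%N | k <- iota 0 r].
Proof. by rewrite map_inj_uniq ?iota_uniq // => k l; lia. Qed.

Lemma nbr_sum_b_end F : nbr_sum (pb q1) F =
  F (pb q1.-1) + \sum_(0 <= k < r1) F (b1 + 2 * k)%N.
Proof.
have Ep : tree_parent r1 r2 h q1 q2 (pb q1) = pb q1.-1 by crush.
rewrite /nbr_sum.
rewrite (@sum_mem_seq _ _ _ (pb q1.-1 :: [seq (b1 + 2 * k)%N | k <- iota 0 r1])).
- by rewrite big_cons big_map /index_iota subn0.
- rewrite /= uniq_even_block mem_even_block; crush.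
- apply/allP => j; rewrite inE mem_even_block; crush.
- move=> j; rewrite inE mem_even_block /tree_adj Ep; crush.
Qed.

Lemma nbr_sum_c_end F : nbr_sum (pc q2) F =
  F (pc q2.-1) + \sum_(0 <= k < r2) F (b2 + 2 * k)%N.
Proof.
have Ep : tree_parent r1 r2 h q1 q2 (pc q2) = pc q2.-1 by crush.
rewrite /nbr_sum.
rewrite (@sum_mem_seq _ _ _ (pc q2.-1 :: [seq (b2 + 2 * k)%N | k <- iota 0 r2])).
- by rewrite big_cons big_map /index_iota subn0.
- rewrite /= uniq_even_block mem_even_block; crush.
- apply/allP => j; rewrite inE mem_even_block; crush.
- move=> j; rewrite inE mem_even_block /tree_adj Ep; crush.
Qed.

End TreeSum.

(* Discards the hypotheses on real numbers, which slow [lia] down. *)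
Ltac nat_lia :=
  repeat match goal with
  | H : forall _, _ |- _ => clear H
  | H : is_true (@Order.le _ _ _ _) |- _ => clear H
  | H : is_true (@Order.lt _ _ _ _) |- _ => clear H
  | H : @eq (Real.sort _) _ _ |- _ => clear H
  end; lia.

(** * Supersolutions on a path and subdivision of an edge *)

(** [kappa * b q] stands for the neighbours of the far end off the path: [kappa] is 0 for the
    pendant path and a branch weight at [v1] and [v2]. Index 0 is the shared vertex [u], whose
    inequality involves all three paths. *)
Definition path_supersolution {R : realType} (lam kappa : R) (q : nat)
    (b : nat -> R) : Prop :=
  (forall i, (0 < i < q)%N -> b i.-1 + b i.+1 <= lam * b i) /\
  b q.-1 + kappa * b q <= lam * b q.

(** Entry 0 occurs only on the smaller sides, so decreasing it preserves the inequalities. This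
    makes the three paths agree at [u] again after one of them has been subdivided. *)
Lemma path_supersolution_lower {R : realType} (lam kappa : R) (q : nat)
    (b : nat -> R) (u : R) : (2 <= q)%N -> u <= b 0%N ->
  path_supersolution lam kappa q b ->
  path_supersolution lam kappa q (fun i => if i is 0 then u else b i).
Proof.
move=> q2 ub [bi bq]; split; last by move: q2 bq; case: q bi => [|[]].
by move=> [|[|i]] // /bi; apply: le_trans; rewrite lerD2r.
Qed.

Lemma min_on_segment {R : realType} (b : nat -> R) (q : nat) :
  exists2 t, (t <= q)%N & forall i, (i <= q)%N -> b t <= b i.
Proof.
elim: q => [|q [t tq tmin]]; first by exists 0%N => // -[].
have [bt|bt] := leP (b t) (b q.+1).
  exists t; first by rewrite ltnW.
  by move=> i; rewrite leq_eqVlt => /orP [/eqP ->//|]; apply: tmin.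
exists q.+1 => // i; rewrite leq_eqVlt => /orP [/eqP ->//|/tmin].
by apply: le_trans; exact: ltW.
Qed.


(* Hoffman-Smith: [s0] and [kappa * b q] are the sums over the neighbours of
   the two ends off the path.  Repeat the smallest entry of [b], unless one of
   these sums is smaller than the value at its end: then insert that sum. *)
Lemma subdivide_path {R : realType} (lam kappa s0 : R) (q : nat) (b : nat -> R) :
  (1 <= q)%N -> 2 <= lam -> (forall i, (i <= q)%N -> 0 < b i) ->
  (forall i, (0 < i < q)%N -> b i.-1 + b i.+1 = lam * b i) ->
  b q.-1 + kappa * b q = lam * b q -> s0 + b 1%N = lam * b 0%N ->
  2 * b 0%N <= lam * s0 -> 2 <= lam * kappa ->
  exists b' : nat -> R, [/\ forall i, (i <= q.+1)%N -> 0 <= b' i, b' 0%N <= b 0%N,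
    s0 + b' 1%N <= lam * b' 0%N & path_supersolution lam kappa q.+1 b'].
Proof.
move=> q1 l2 bp bi bq b0 s0b k2.
have bp0 : 0 < b 0%N by exact: bp.
have bpq : 0 < b q by exact: bp.
have s0p : 0 < s0 by nra.
have kp : 0 < kappa by nra.
(* Append [kappa * b q]. The new end requires [1 + kappa^2 <= lam * kappa], which follows from
   [kappa <= 1] and [2 <= lam * kappa]. *)
have [k1|k1] := leP kappa 1.
  exists (fun i => if (i <= q)%N then b i else kappa * b q); split.
  - by move=> i _; case: leqP => [/bp/ltW//|_]; rewrite mulr_ge0 // ltW.
  - by [].
  - by rewrite q1 b0.
  split=> [i /andP [i0 iq]|]; last first.
    rewrite /= leqnn ltnn.
    suff : 0 <= (lam * kappa - 1 - kappa ^+ 2) * b q by nra.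
    apply: mulr_ge0; [nra|exact: ltW].
  have -> : (i <= q)%N by nat_lia.
  have -> : (i.-1 <= q)%N by nat_lia.
  case: leqP => iq' /=; last by rewrite bi // i0.
  have -> : i = q by nat_lia.
  by rewrite bq.
(* Prepend [s0]. The new start requires [s0 + b 0 <= lam * s0], which follows from [s0 <= b 0] and
   [2 * b 0 <= lam * s0]. *)
have [s1|s1] := leP s0 (b 0%N).
  exists (fun i => if i is j.+1 then b j else s0); split => //.
  - by case=> [|i] iq; apply/ltW => //; exact: bp.
  - nra.
  split=> [[|[|i]] //=|]; first by rewrite b0.
    by move=> iq; rewrite (bi i.+1).
  by move: q1 bq => /=; case: (q) => // m _ /= ->.
(* At each copy of the minimum [b t], the other copy replaces a former neighbour that is at least as
   large. If [t] is an end of the path, that neighbour term is [s0 > b 0] or [kappa * b q > b q]. *)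
have [t tq tmin] := min_on_segment b q.
exists (fun i => if (i <= t)%N then b i else b i.-1); split.
- by move=> i iq; case: leqP => it; apply/ltW/bp; nat_lia.
- by [].
- case: leqP => t0 /=; last by rewrite b0.
  have := tmin 1%N q1; have -> : t = 0%N by nat_lia.
  by rewrite -b0 => ?; rewrite lerD2l.
split=> [i /andP [i0 iq]|].
  have [it|it|it] := ltngtP i t.
  - have -> : (i.-1 <= t)%N by nat_lia.
    by rewrite /= bi //; nat_lia.
  - have [it'|it'] := leqP i.-1 t; last first.
      by rewrite /= -[X in _ + b X <= _](prednK i0) bi //; nat_lia.
    have Et : i = t.+1 by nat_lia.
    rewrite Et /= in iq *; have tq' : (t < q)%N by nat_lia.
    have [Et0|t0] := eqVneq t 0%N.
      by rewrite Et0 /= -b0 lerD2r ltW.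
    rewrite -bi ?lerD2r; last by nat_lia.
    by apply: tmin; nat_lia.
  - have -> : (i.-1 <= t)%N by nat_lia.
    rewrite it /=; have [tq'|tq'] := eqVneq t q.
      rewrite tq' -bq lerD2l; nra.
    rewrite -bi ?lerD2l; last by nat_lia.
    by apply: tmin; nat_lia.
have -> : (q.+1 <= t)%N = false by nat_lia.
rewrite /=; case: leqP => qt.
  by rewrite -bq lerD2r -(_ : t = q) ?tmin //; nat_lia.
by rewrite bq.
Qed.

(** * Perron vectors of the trees and their profiles along the three paths *)

Lemma tree_adjmx_sym (R : realType) (r1 r2 h q1 q2 : nat) :
  (tree_adjmx R r1 r2 h q1 q2)^T = tree_adjmx R r1 r2 h q1 q2.
Proof. by apply/matrixP => i j; rewrite !mxE /tree_adj orbC. Qed.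

(** At a zero entry the eigenvalue equation is a vanishing sum of nonnegative terms, so all
    neighbours are zero too. A zero thus travels through parents to the root, and from there to
    every vertex. *)
Lemma tree_perron (R : realType) (r1 r2 h q1 q2 : nat) :
  let A := tree_adjmx R r1 r2 h q1 q2 in
  exists2 x : 'rV_(tree_order r1 r2 h q1 q2),
    forall i, 0 < x 0 i & x *m A = spectral_radius A *: x.
Proof.
move=> A; have n0 : (0 < tree_order r1 r2 h q1 q2)%N.
  by rewrite /tree_order; nat_lia.
have A0 i j : 0 <= A i j by rewrite mxE ler0n.
have [x [x0 xp xA]] := perron_nonneg A n0 (tree_adjmx_sym R r1 r2 h q1 q2) A0.
exists x => // i; rewrite lt_def xp andbT.
have prop (k j : 'I_(tree_order r1 r2 h q1 q2)) :
    tree_adj r1 r2 h q1 q2 k j -> x 0 j = 0 -> x 0 k = 0.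
  move=> kj xj; move/matrixP: xA => /(_ 0 j); rewrite !mxE xj mulr0.
  move=> /psumr_eq0P h0; have := h0 (fun l _ => mulr_ge0 (xp l) (A0 l j)) k isT.
  by rewrite mxE kj mulr1.
have parent_ord (j : 'I_(tree_order r1 r2 h q1 q2)) : (0 < j)%N ->
    exists2 k : 'I_(tree_order r1 r2 h q1 q2), (k < j)%N &
    tree_adj r1 r2 h q1 q2 k j /\ tree_adj r1 r2 h q1 q2 j k.
  move=> j0; have pj := tree_parent_lt r1 r2 h q1 q2 j j0.
  exists (Ordinal (ltn_trans pj (ltn_ord j))) => //.
  by rewrite /tree_adj /= j0 eqxx orbT.
apply: contraNneq x0 => xi0.
have x00 : x 0 (Ordinal n0) = 0.
  have [m mi] := ubnP (nat_of_ord i); elim: m => // m IH in i mi xi0 *.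
  have [i0|i0] := posnP i.
    by rewrite -[RHS]xi0; congr (x 0 _); apply: val_inj; rewrite /= i0.
  have [k ki [ak _]] := parent_ord i i0.
  by apply: (IH k); [nat_lia|exact: prop ak xi0].
apply/eqP/rowP => j; rewrite mxE.
have [m mj] := ubnP (nat_of_ord j); elim: m => // m IH in j mj *.
have [j0|j0] := posnP j.
  by rewrite -[RHS]x00; congr (x 0 _); apply: val_inj; rewrite /= j0.
have [k kj [_ ak]] := parent_ord j j0.
by apply: prop ak _; apply: IH; nat_lia.
Qed.

(** Solving [lam * l = m] and [lam * m = w + l] on a pendant path with middle value [m], leaf value
    [l] and attachment value [w] gives [m = lam / (lam^2 - 1) * w]; there are [r] such paths. *)
Definition branch_weight {R : realType} (lam : R) (r : nat) : R :=
  r%:R * (lam / (lam ^+ 2 - 1)).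

(** The three profiles are glued at [u] and extended over the pendant paths with 2 edges, which
    yields a test vector for [spectral_radius_lt]. *)
Lemma tree_spectral_radius_lt (R : realType) (r1 r2 h q1 q2 : nat) (lam : R)
    (a b c : nat -> R) :
  (2 <= h)%N -> (2 <= q1)%N -> (2 <= q2)%N -> 1 < lam ->
  (forall i, (i <= h)%N -> 0 <= a i) ->
  (forall i, (i <= q1)%N -> 0 <= b i) ->
  (forall i, (i <= q2)%N -> 0 <= c i) ->
  b 0%N = a 0%N -> c 0%N = a 0%N ->
  path_supersolution lam 0 h a -> a h.-1 < lam * a h ->
  path_supersolution lam (branch_weight lam r1) q1 b ->
  path_supersolution lam (branch_weight lam r2) q2 c ->
  a 1%N + b 1%N + c 1%N <= lam * a 0%N ->
  spectral_radius (tree_adjmx R r1 r2 h q1 q2) < lam.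
Proof.
move=> h2 q12 q22 l1 a0 b0 c0 ba ca [aP _] aS [bP bE] [cP cE] uP.
have D0 : 0 < lam ^+ 2 - 1 by nra.
have l0 : 0 < lam by lra.
set n := tree_order r1 r2 h q1 q2.
pose leaf x := x / (lam ^+ 2 - 1).
(* Past the three paths, even offsets are middle vertices and odd ones leaves; their values solve
   the eigenvalue equations there exactly. *)
pose F (k : nat) : R :=
  if (k <= h)%N then a k else if (k <= h + q1)%N then b (k - h)%N
  else if (k <= h + q1 + q2)%N then c (k - (h + q1))%N
  else let b1 := (h + q1 + q2 + 1)%N in
  let x := if (k < b1 + 2 * r1)%N then b q1 else c q2 in
  if odd (k - b1) then leaf x else lam * leaf x.
have Fa i : (i <= h)%N -> F (path_vertex 0 i) = a i.
  by move=> ih; rewrite /F /path_vertex; case: eqP => [->|_] //; rewrite add0n ih.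
have Fb i : (i <= q1)%N -> F (path_vertex h i) = b i.
  move=> ih; rewrite /F /path_vertex; case: eqP => [->|i0] //.
  have -> : (h + i <= h)%N = false by nat_lia.
  by rewrite leq_add2l ih addKn.
have Fc i : (i <= q2)%N -> F (path_vertex (h + q1) i) = c i.
  move=> ih; rewrite /F /path_vertex; case: eqP => [->|i0] //.
  have -> : (h + q1 + i <= h)%N = false by nat_lia.
  have -> : (h + q1 + i <= h + q1)%N = false by nat_lia.
  by rewrite leq_add2l ih addKn.
have Ft m : F (h + q1 + q2 + 1 + m)%N =
    let x := if (m < 2 * r1)%N then b q1 else c q2 in
    if odd m then leaf x else lam * leaf x.
  rewrite /F; have -> : (h + q1 + q2 + 1 + m <= h)%N = false by nat_lia.
  have -> : (h + q1 + q2 + 1 + m <= h + q1)%N = false by nat_lia.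
  have -> : (h + q1 + q2 + 1 + m <= h + q1 + q2)%N = false by nat_lia.
  by rewrite addKn ltn_add2l.
have Fm1 k : (k < r1)%N -> F (h + q1 + q2 + 1 + 2 * k)%N = lam * leaf (b q1) /\
    F (h + q1 + q2 + 1 + 2 * k + 1)%N = leaf (b q1).
  move=> kr; rewrite -(addnA _ (2 * k) 1)%N !Ft !mul2n addn1 /= odd_double /=.
  by rewrite ltn_Sdouble ltn_double kr.
have Fm2 k : (k < r2)%N ->
    F (h + q1 + q2 + 1 + 2 * r1 + 2 * k)%N = lam * leaf (c q2) /\
    F (h + q1 + q2 + 1 + 2 * r1 + 2 * k + 1)%N = leaf (c q2).
  move=> kr; rewrite -!(addnA (h + q1 + q2 + 1)%N) !Ft !mul2n addn1 /=.
  rewrite -doubleD odd_double /=.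
  by rewrite ltn_Sdouble ltn_double ltnNge leq_addr.
have leaf0 x : 0 <= x -> 0 <= leaf x by move=> x0; rewrite /leaf divr_ge0 // ltW.
have leafE x : x + leaf x = lam * (lam * leaf x).
  by rewrite /leaf; field; apply: lt0r_neq0.
have weightE r x : r%:R * (lam * leaf x) = branch_weight lam r * x.
  by rewrite /leaf /branch_weight; ring.
have F0 i : 0 <= F i.
  rewrite /F /=; case: (leqP i h) => ih; first exact: a0.
  case: (leqP i (h + q1)) => ib; first by apply: b0; nat_lia.
  case: (leqP i (h + q1 + q2)) => ic; first by apply: c0; nat_lia.
  have x0 : 0 <= (if (i < h + q1 + q2 + 1 + 2 * r1)%N then b q1 else c q2).
    by case: ifP => _; [apply: b0|apply: c0].
  by case: (odd _); [exact: leaf0|apply: mulr_ge0; [exact: ltW|exact: leaf0]].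
have le_nbr i : (i < n)%N -> nbr_sum r1 r2 h q1 q2 i F <= lam * F i.
  move: i; apply: (nbr_sum_cases r1 r2 h q1 q2 h2 q12 q22
    (fun i => nbr_sum r1 r2 h q1 q2 i F <= lam * F i)) => /=.
  - by rewrite nbr_sum_u // Fa ?Fb ?Fc ?(Fa 0%N isT) //; nat_lia.
  - by move=> i ih; rewrite nbr_sum_a // !Fa; try nat_lia; apply: aP.
  - rewrite nbr_sum_a_end // !Fa; try nat_lia; exact: ltW.
  - by move=> i ih; rewrite nbr_sum_b // !Fb; try nat_lia; apply: bP.
  - rewrite nbr_sum_b_end // !Fb; try nat_lia.
    rewrite (eq_big_nat _ _ (F2 := fun=> lam * leaf (b q1))); last first.
      by move=> k /andP [_ kr]; case: (Fm1 k kr).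
    apply: le_trans bE; rewrite lerD2l sumr_const_nat subn0 -mulr_natl.
    by rewrite weightE.
  - by move=> i ih; rewrite nbr_sum_c // !Fc; try nat_lia; apply: cP.
  - rewrite nbr_sum_c_end // !Fc; try nat_lia.
    rewrite (eq_big_nat _ _ (F2 := fun=> lam * leaf (c q2))); last first.
      by move=> k /andP [_ kr]; case: (Fm2 k kr).
    apply: le_trans cE; rewrite lerD2l sumr_const_nat subn0 -mulr_natl.
    by rewrite weightE.
  - move=> k kr; rewrite nbr_sum_mid1 // nbr_sum_leaf1 // Fb //.
    by have [-> ->] := Fm1 k kr; rewrite leafE.
  - move=> k kr; rewrite nbr_sum_mid2 // nbr_sum_leaf2 // Fc //.
    by have [-> ->] := Fm2 k kr; rewrite leafE.
have hn : (h < n)%N by rewrite /n /tree_order; nat_lia.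
have [z z0 zA] := tree_perron R r1 r2 h q1 q2.
(* Vertex [h] is the leaf of the pendant path, where [a h.-1 < lam * a h] gives strictness. *)
apply: (spectral_radius_lt _ _ (\row_(i < n) F i) z (Ordinal hn)) => //.
- exact: tree_adjmx_sym.
- by move=> i; rewrite mxE.
- move=> i; rewrite mxE; apply: le_trans (le_nbr i (ltn_ord i)).
  by rewrite le_eqVlt; apply/orP; left; apply/eqP/eq_bigr => j _; rewrite !mxE.
- rewrite mxE /=.
  rewrite (eq_bigr (fun j : 'I_n => (tree_adj r1 r2 h q1 q2 h j)%:R * F j)).
    have := nbr_sum_a_end r1 r2 h q1 q2 h2 q12 q22 F.
    rewrite Fa; last by nat_lia.
    have -> : path_vertex 0 h = h by rewrite /path_vertex; case: eqP; nat_lia.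
    by rewrite /nbr_sum => ->; rewrite /F leqnn.
  by move=> j _; rewrite !mxE.
Qed.

(** Reads the Perron vector along the three paths and eliminates the pendant paths with 2 edges, the
    reverse of the gluing above. *)
Lemma tree_perron_profile (R : realType) (r1 r2 h q1 q2 : nat) :
  (2 <= h)%N -> (2 <= q1)%N -> (2 <= q2)%N -> (3 <= r2)%N ->
  let lam := spectral_radius (tree_adjmx R r1 r2 h q1 q2) in
  2 <= lam /\ exists a b c : nat -> R,
  [/\ [/\ forall i, (i <= h)%N -> 0 < a i, forall i, (i <= q1)%N -> 0 < b i &
      forall i, (i <= q2)%N -> 0 < c i],
    [/\ b 0%N = a 0%N, c 0%N = a 0%N & a 1%N + b 1%N + c 1%N = lam * a 0%N],
    (forall i, (0 < i < h)%N -> a i.-1 + a i.+1 = lam * a i) /\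
    a h.-1 = lam * a h,
    (forall i, (0 < i < q1)%N -> b i.-1 + b i.+1 = lam * b i) /\
    b q1.-1 + branch_weight lam r1 * b q1 = lam * b q1 &
    (forall i, (0 < i < q2)%N -> c i.-1 + c i.+1 = lam * c i) /\
    c q2.-1 + branch_weight lam r2 * c q2 = lam * c q2].
Proof.
move=> h2 q12 q22 r23 lam; set n := tree_order r1 r2 h q1 q2.
have [x x0 xA] := tree_perron R r1 r2 h q1 q2.
pose F k := if insub k is Some i then x 0 (i : 'I_n) else 0.
have FE (i : 'I_n) : F i = x 0 i by rewrite /F valK.
have Fp i : (i < n)%N -> 0 < F i.
  by move=> ilt; rewrite -[i]/(val (Ordinal ilt)) FE.
have FN i : (i < n)%N -> nbr_sum r1 r2 h q1 q2 i F = lam * F i.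
  move=> ilt; rewrite -[i]/(val (Ordinal ilt)) FE.
  move/matrixP: xA => /(_ 0 (Ordinal ilt)); rewrite [RHS]mxE -/lam => <-.
  rewrite mxE; apply: eq_bigr => j _.
  by rewrite mxE /= FE mulrC /tree_adj orbC.
have lta i : (i <= h)%N -> (path_vertex 0 i < n)%N.
  by rewrite /path_vertex /n /tree_order; case: eqP; nat_lia.
have ltb i : (i <= q1)%N -> (path_vertex h i < n)%N.
  by rewrite /path_vertex /n /tree_order; case: eqP; nat_lia.
have ltc i : (i <= q2)%N -> (path_vertex (h + q1) i < n)%N.
  by rewrite /path_vertex /n /tree_order; case: eqP; nat_lia.
have Fm1 k : (k < r1)%N ->
    lam * F (h + q1 + q2 + 1 + 2 * k + 1)%N = F (h + q1 + q2 + 1 + 2 * k)%N /\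
    lam * F (h + q1 + q2 + 1 + 2 * k)%N =
    F (path_vertex h q1) + F (h + q1 + q2 + 1 + 2 * k + 1)%N.
  move=> kr; rewrite -!FN ?nbr_sum_mid1 ?nbr_sum_leaf1 // /n /tree_order; nat_lia.
have Fm2 k : (k < r2)%N ->
    lam * F (h + q1 + q2 + 1 + 2 * r1 + 2 * k + 1)%N =
    F (h + q1 + q2 + 1 + 2 * r1 + 2 * k)%N /\
    lam * F (h + q1 + q2 + 1 + 2 * r1 + 2 * k)%N =
    F (path_vertex (h + q1) q2) + F (h + q1 + q2 + 1 + 2 * r1 + 2 * k + 1)%N.
  move=> kr; rewrite -!FN ?nbr_sum_mid2 ?nbr_sum_leaf2 // /n /tree_order; nat_lia.
have lam0 : 0 < lam.
  have := FN 0%N (lta 0%N isT); rewrite nbr_sum_u //.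
  have := Fp _ (lta 0%N isT); have := Fp _ (lta 1%N (ltnW h2)).
  have := Fp _ (ltb 1%N (ltnW q12)); have := Fp _ (ltc 1%N (ltnW q22)).
  rewrite /=; nra.
have c_end : F (path_vertex (h + q1) q2.-1) +
    \sum_(0 <= k < r2) F (h + q1 + q2 + 1 + 2 * r1 + 2 * k)%N =
    lam * F (path_vertex (h + q1) q2).
  by rewrite -(nbr_sum_c_end r1 r2 h q1 q2) // FN // ltc.
(* Each of the [r2 + 1 >= 4] neighbours of [v2] has value at least [w / lam], where [w] is the value
   at [v2]. Hence [lam * w >= 4 * w / lam], that is [lam^2 >= 4]. *)
have l2 : 2 <= lam.
  pose w := F (path_vertex (h + q1) q2).
  have w0 : 0 < w by apply: Fp; apply: ltc.
  have mid k : (k < r2)%N -> w / lam <= F (h + q1 + q2 + 1 + 2 * r1 + 2 * k)%N.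
    move=> kr; have [_ E] := Fm2 k kr; rewrite ler_pdivrMr // mulrC E lerDl.
    apply/ltW/Fp; rewrite /n /tree_order; nat_lia.
  have prev : w / lam <= F (path_vertex (h + q1) q2.-1).
    rewrite ler_pdivrMr // mulrC -FN; last by apply: ltc; nat_lia.
    rewrite nbr_sum_c //; last by nat_lia.
    rewrite prednK ?lerDr; last by nat_lia.
    by apply/ltW/Fp; apply: ltc; nat_lia.
  have sums : r2%:R * (w / lam) <=
      \sum_(0 <= k < r2) F (h + q1 + q2 + 1 + 2 * r1 + 2 * k)%N.
    rewrite mulr_natl -[X in _ *+ X](subn0 r2) -sumr_const_nat.
    by rewrite !big_mkord; apply: ler_sum => k _; apply: mid.
  have r2R : 3 <= r2%:R :> R by rewrite ler_nat.
  have wl0 : 0 < w / lam by rewrite divr_gt0.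
  have : 4 * (w / lam) <= lam * (lam * (w / lam)).
    have -> : lam * (w / lam) = w by field; apply: lt0r_neq0.
    rewrite -c_end; nra.
  rewrite [X in _ <= X]mulrA ler_pM2r // => ll; nra.
split=> //.
have D0 : lam ^+ 2 - 1 != 0 by apply: lt0r_neq0; nra.
have midE w m l : lam * l = m -> lam * m = w + l :> R ->
    m = lam / (lam ^+ 2 - 1) * w.
  move=> <- E; have -> : w = (lam ^+ 2 - 1) * l.
    by rewrite -[LHS](addrK l) -E; ring.
  by rewrite mulrA divfK.
exists (fun i => F (path_vertex 0 i)), (fun i => F (path_vertex h i)),
  (fun i => F (path_vertex (h + q1) i)); split.
- by split=> i ih; apply: Fp; [exact: lta|exact: ltb|exact: ltc].
- by split=> //; rewrite -(nbr_sum_u r1 r2 h q1 q2) // FN // (lta 0%N).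
- split=> [i ih|]; last by rewrite -(nbr_sum_a_end r1 r2 h q1 q2) // FN // lta.
  by rewrite -(nbr_sum_a r1 r2 h q1 q2) // FN // lta //; nat_lia.
- split=> [i ih|].
    by rewrite -(nbr_sum_b r1 r2 h q1 q2) // FN // ltb //; nat_lia.
  rewrite -FN ?ltb // nbr_sum_b_end //; congr (_ + _).
  rewrite (eq_big_nat _ _
    (F2 := fun=> lam / (lam ^+ 2 - 1) * F (path_vertex h q1))).
    by rewrite sumr_const_nat subn0 -mulr_natl /branch_weight; ring.
  by move=> k /andP [_ kr]; have [E1 E2] := Fm1 k kr; apply: midE E1 E2.
- split=> [i ih|].
    by rewrite -(nbr_sum_c r1 r2 h q1 q2) // FN // ltc //; nat_lia.
  rewrite -c_end; congr (_ + _).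
  rewrite (eq_big_nat _ _
    (F2 := fun=> lam / (lam ^+ 2 - 1) * F (path_vertex (h + q1) q2))).
    by rewrite sumr_const_nat subn0 -mulr_natl /branch_weight; ring.
  by move=> k /andP [_ kr]; have [E1 E2] := Fm2 k kr; apply: midE E1 E2.
Qed.

(** * Moving one edge from the pendant path to an internal path *)

Theorem theorem4p1 (R : realType) (r1 r2 h q1 q2 h' q1' q2' : nat) :
  (2 <= r1)%N -> (r1 < r2)%N ->
  (3 <= h)%N -> (2 <= q1)%N -> (2 <= q2)%N ->
  ((h' = h.-1 /\ q1' = q1.+1 /\ q2' = q2) \/
   (h' = h.-1 /\ q1' = q1 /\ q2' = q2.+1)) ->
  spectral_radius (tree_adjmx R r1 r2 h' q1' q2') <
  spectral_radius (tree_adjmx R r1 r2 h q1 q2).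
Proof.
move=> r12 r1r2; case: h => [|[|[|h]]] // _ q12 q22 /= cases.
have [l2] := @tree_perron_profile R r1 r2 h.+3 q1 q2 isT q12 q22
  (leq_ltn_trans r12 r1r2).
set lam := spectral_radius (tree_adjmx R r1 r2 h.+3 q1 q2) in l2 *.
move=> [a [b [c [[ap bp cp] [ba ca uE] [aE ah] [bE bq] [cE cq]]]]].
(* The condition on [kappa] for subdividing: [lam * branch_weight lam r] is [r] times
   [lam^2 / (lam^2 - 1) >= 1]. *)
have wt r : (2 <= r)%N -> 2 <= lam * branch_weight lam r.
  move=> r2'; have rR : 2 <= r%:R :> R by rewrite ler_nat.
  have D0 : 0 < lam ^+ 2 - 1 by nra.
  have -> : lam * branch_weight lam r = r%:R * (lam ^+ 2 / (lam ^+ 2 - 1)).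
    by rewrite /branch_weight; ring.
  have : 1 <= lam ^+ 2 / (lam ^+ 2 - 1) by rewrite ler_pdivlMr // mul1r; lra.
  move: (_ / _) => t t1; nra.
have a0 : 0 < a 0%N by exact: ap.
(* Added over the two paths that are not subdivided, this gives the condition [2 * b 0 <= lam * s0]
   for subdividing. *)
have near f q : (2 <= q)%N -> (forall i, (i <= q)%N -> 0 < f i) ->
    (forall i, (0 < i < q)%N -> f i.-1 + f i.+1 = lam * f i) ->
    f 0%N <= lam * f 1%N :> R.
  by move=> q2q fp fE; rewrite -fE // lerDl; apply/ltW/fp.
have na := near a h.+3 isT ap aE.
have nb := near b q1 q12 bp bE.
have nc := near c q2 q22 cp cE.
(* Since [h] now counts from 3, the shortened pendant path has [h.+2] edges. Dropping the positive
   value at the old leaf makes the inequality at the new leaf strict. *)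
have aS : path_supersolution lam 0 h.+2 a.
  split=> [i ih|]; first by rewrite aE //; nat_lia.
  rewrite mul0r addr0 -(aE h.+2) /=; last by nat_lia.
  by rewrite lerDl; apply/ltW/ap; nat_lia.
have aS' : a h.+1 < lam * a h.+2.
  by rewrite -(aE h.+2) /= ?ltrDl ?ap //; nat_lia.
have l1 : 1 < lam by lra.
have lower f q u : (forall i, (i <= q)%N -> 0 < f i) -> 0 <= u ->
    forall i, (i <= q)%N -> 0 <= (if i is 0 then u else f i) :> R.
  by move=> fp u0 [|i] // iq; apply/ltW/fp.
have ah' : forall i, (i <= h.+2)%N -> 0 < a i by move=> i ih; apply: ap; nat_lia.
case: cases => [[-> [-> ->]]|[-> [-> ->]]].
- have [|||b' [b'p b'0 b'u b'S]] := @subdivide_path R lam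
    (branch_weight lam r1) (a 1%N + c 1%N) q1 b (ltnW q12) l2 bp bE bq.
  + by rewrite addrAC uE ba.
  + by rewrite ba; lra.
  + exact: wt.
  (* Subdividing may have lowered the value at [u], so [a] and [c] take the value [b' 0] at index
     0. *)
  have u0 := b'p 0%N isT.
  rewrite ba in b'0; have c'0 : b' 0%N <= c 0%N by rewrite ca.
  apply: (tree_spectral_radius_lt R r1 r2 h.+2 q1.+1 q2 lam
    (fun i => if i is 0 then b' 0%N else a i) b'
    (fun i => if i is 0 then b' 0%N else c i)) => //; try exact: lower.
  + by rewrite leqW.
  + exact: path_supersolution_lower.
  + apply: path_supersolution_lower => //; split=> [i iq|]; by rewrite ?cE ?cq.
  + by rewrite addrAC.
- have [|||c' [c'p c'0 c'u c'S]] := @subdivide_path R lam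
    (branch_weight lam r2) (a 1%N + b 1%N) q2 c (ltnW q22) l2 cp cE cq.
  + by rewrite uE ca.
  + by rewrite ca; lra.
  + by apply: wt; nat_lia.
  have u0 := c'p 0%N isT.
  rewrite ca in c'0; have b'0 : c' 0%N <= b 0%N by rewrite ba.
  apply: (tree_spectral_radius_lt R r1 r2 h.+2 q1 q2.+1 lam
    (fun i => if i is 0 then c' 0%N else a i)
    (fun i => if i is 0 then c' 0%N else b i) c') => //; try exact: lower.
  + by rewrite leqW.
  + exact: path_supersolution_lower.
  + apply: path_supersolution_lower => //; split=> [i iq|]; by rewrite ?bE ?bq.
Qed.
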